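(* (a) Let $S$ be a spray on an $n$-dimensional manifold $M$ ($n\ge2$) with Jacobi endomorphism $\Phi$. If $\operatorname{rank}\, dd_J(\operatorname{Tr}\Phi)=2n$, then $S$ has non-vanishing Ricci curvature. (b) If a spray $S$ has non-vanishing Ricci curvature, then $\operatorname{rank}\, dd_J(\operatorname{Tr}\Phi)$ is not necessarily maximal: there exists a spray $S$ on a manifold of some dimension $n\geq2$ with non-vanishing Ricci curvature for which the rank of $dd_J(\operatorname{Tr}\Phi)$ is not equal to $2n$.
   Context: Let $(x^i,y^i)$ be the induced coordinates on $TM$ and $\mathcal{T}M$ the set of non-zero tangent vectors. A spray is a vector field on $\mathcal{T}M$ of local form $S=y^i\frac{\partial}{\partial x^i}-2G^i(x,y)\frac{\partial}{\partial y^i}$ with $G^i$ positively $2$-homogeneous in $y$. Its Jacobi endomorphism is $\Phi=R^i_{\ j}\frac{\partial}{\partial y^i}\otimes dx^j$, $R^i_{\ j}=2\frac{\partial G^i}{\partial x^j}-S(N^i_j)-N^i_kN^k_j$, $N^i_j=\frac{\partial G^i}{\partial y^j}$, and the Ricci curvature is $\mathrm{Ric}=\operatorname{Tr}\Phi=R^i_{\ i}$, a function on $\mathcal{T}M$. ''Non-vanishing Ricci curvature'' means that $\mathrm{Ric}$ is not identically zero. For a function $f$ on $\mathcal{T}M$, $d_Jf=\frac{\partial f}{\partial y^i}dx^i$, and $dd_Jf$ is its exterior derivative, a $2$-form on the $2n$-dimensional manifold $\mathcal{T}M$; the condition $\operatorname{rank}\,dd_Jf=2n$ means that this $2$-form is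 non-degenerate at every point of $\mathcal{T}M$. *)

(* Defs.v *)
From HB Require Import structures.
From mathcomp Require Import all_boot all_order all_algebra.
From mathcomp Require Import all_classical all_reals all_analysis.
Set Implicit Arguments.
Unset Strict Implicit.
Unset Printing Implicit Defensive.
Import Order.TTheory GRing.Theory Num.Theory.
Import numFieldNormedType.Exports.
Local Open Scope classical_set_scope.
Local Open Scope ring_scope.

(* C^k and C^oo on an open set U, for V finite-dimensional.  Derivatives are
   only constrained at points of U, where they do not depend on the values of f
   outside U. *)
Fixpoint ck_on (R : realType) (V W : normedModType R) (k : nat)
    (U : set V) (f : V -> W) : Prop :=
  if k is k'.+1 then
    (forall p, U p -> differentiable f p) /\
    (forall v, ck_on k' U (fun p => 'D_v f p))
  else forall p, U p -> {for p, continuous f}.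

Definition smooth_on (R : realType) (V W : normedModType R)
    (U : set V) (f : V -> W) : Prop := forall k, ck_on k U f.

(* A nonempty smooth n-manifold given by an atlas; [chart_inv i] is only
   meaningful on the image of [chart i]. *)
Record manifold (R : realType) (n : nat) := Manifold {
  carrier :> topologicalType ;
  atlas : Type ;
  dom : atlas -> set carrier ;
  chart : atlas -> carrier -> 'rV[R]_n ;
  chart_inv : atlas -> 'rV[R]_n -> carrier ;
  manifold_nonempty : [set: carrier] !=set0 ;
  manifold_hausdorff : hausdorff_space carrier ;
  manifold_second_countable : @second_countable carrier ;
  dom_open : forall i, open (dom i) ;
  dom_cover : forall q, exists i, dom i q ;
  chart_image_open : forall i, open (chart i @` dom i) ;
  chartK : forall i q, dom i q -> chart_inv i (chart i q) = q ;
  chart_continuous : forall i q, dom i q -> {for q, continuous (chart i)} ;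
  chart_inv_continuous : forall i x, (chart i @` dom i) x ->
    {for x, continuous (chart_inv i)} ;
  transition_smooth : forall i j,
    smooth_on (chart i @` (dom i `&` dom j)) (chart j \o chart_inv i) }.

Definition transition (R : realType) (n : nat) (M : manifold R n)
  (i j : atlas M) : 'rV[R]_n -> 'rV[R]_n := chart j \o chart_inv i.

(* Induced coordinates p = (x, y) on TM live in 'rV_n * 'rV_n.  The set of
   coordinates, in the chart i, of the nonzero tangent vectors based in U: *)
Definition slit_coords (R : realType) (n : nat) (M : manifold R n)
  (i : atlas M) (U : set M) : set ('rV[R]_n * 'rV[R]_n) :=
  [set p | (chart i @` U) p.1 /\ p.2 != 0].

Definition tangent_map (R : realType) (n : nat) (tau : 'rV[R]_n -> 'rV[R]_n)
  (p : 'rV[R]_n * 'rV[R]_n) : 'rV[R]_n * 'rV[R]_n :=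
  (tau p.1, 'd tau (p.1) p.2).

Section LocalCoordinates.
Variables (R : realType) (n : nat).
Local Notation E := 'rV[R]_n.

Definition dx (i : 'I_n) (f : E * E -> R) (p : E * E) : R :=
  'D_((delta_mx 0 i, 0) : E * E) f p.

Definition dy (i : 'I_n) (f : E * E -> R) (p : E * E) : R :=
  'D_((0, delta_mx 0 i) : E * E) f p.

(* y^i d/dx^i - 2 G^i d/dy^i, as the pair of its x- and y-components *)
Definition spray_field (G : E * E -> E) (p : E * E) : E * E :=
  (p.2, - (2 *: G p)).

Definition coef (G : E * E -> E) (i : 'I_n) (p : E * E) : R := G p 0 i.

Definition nonlin_connection (G : E * E -> E) (i j : 'I_n) : E * E -> R :=
  dy j (coef G i).

Definition jacobi_endomorphism (G : E * E -> E) (p : E * E) : 'M[R]_n :=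
  \matrix_(i, j)
    (2 * dx j (coef G i) p
     - 'D_(spray_field G p) (nonlin_connection G i j) p
     - \sum_(k < n) nonlin_connection G i k p * nonlin_connection G k j p).

Definition ricci (G : E * E -> E) (p : E * E) : R :=
  \tr (jacobi_endomorphism G p).

(* In 'I_(n + n) the first n indices are those of x, the last n those of y. *)
Definition dcoord (a : 'I_(n + n)) : (E * E -> R) -> E * E -> R :=
  match fintype.split a with inl i => dx i | inr i => dy i end.

Definition dJ (f : E * E -> R) (a : 'I_(n + n)) : E * E -> R :=
  match fintype.split a with inl i => dy i f | inr _ => fun=> 0 end.

(* (d theta)_ab for the 1-form with components theta_a; the exterior derivative
   is normalised by d theta (u, v) = u(theta v) - v(theta u) on constant fields *)
Definition ext_d (theta : 'I_(n + n) -> E * E -> R) (p : E * E)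
  : 'M[R]_(n + n) :=
  \matrix_(a, b) (dcoord a (theta b) p - dcoord b (theta a) p).

Definition ddJ (f : E * E -> R) : E * E -> 'M[R]_(n + n) := ext_d (dJ f).

End LocalCoordinates.

(* A spray is given by its local coefficients G^i in each chart;
   [spray_compat] says that the local fields y^i d/dx^i - 2 G^i d/dy^i are
   related by the coordinate changes of TM, i.e. define one vector field on the
   slit tangent bundle. *)
Record spray (R : realType) (n : nat) (M : manifold R n) := Spray {
  spray_coef :> atlas M -> 'rV[R]_n * 'rV[R]_n -> 'rV[R]_n ;
  spray_smooth : forall i, smooth_on (slit_coords i (dom i)) (spray_coef i) ;
  spray_homogeneous : forall i p (c : R), slit_coords i (dom i) p -> 0 < c ->
    spray_coef i (p.1, c *: p.2) = c ^+ 2 *: spray_coef i p ;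
  spray_compat : forall i j p, slit_coords i (dom i `&` dom j) p ->
    'd (tangent_map (transition i j)) p (spray_field (spray_coef i) p)
    = spray_field (spray_coef j) (tangent_map (transition i j) p) }.

(* A function on the slit tangent bundle is handled through its coordinate
   representatives, so that a pointwise condition is required in every chart of
   the atlas. *)
Definition nonvanishing_ricci (R : realType) (n : nat) (M : manifold R n)
    (S : spray M) : Prop :=
  ~ (forall i p, slit_coords i (dom i) p -> ricci (S i) p = 0).

Definition ddJ_trace_full_rank (R : realType) (n : nat) (M : manifold R n)
    (S : spray M) : Prop :=
  forall i p, slit_coords i (dom i) p ->
    \rank (ddJ (fun q => \tr (jacobi_endomorphism (S i) q)) p) = (2 * n)%N.

(* Main.v *)
Require Import Defs.
From HB Require Import structures.
From mathcomp Require Import all_boot all_order all_algebra.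
From mathcomp Require Import all_classical all_reals all_analysis.

Import Order.TTheory GRing.Theory Num.Theory.
Import numFieldNormedType.Exports.

Set Implicit Arguments.
Unset Strict Implicit.
Unset Printing Implicit Defensive.

(** Part (a) is a statement about zeros.  If the Ricci curvature vanished
    identically, then its coordinate representatives would vanish on the sets
    of coordinates of nonzero tangent vectors; these sets are open
    ([slit_coords_open]), so all derivatives of the representatives vanish
    there too, and dd_J Ric is the zero form ([ddJ_eq0_open]).  Its rank 0 is
    not 2n, because n > 0 and the manifold is nonempty, so that at least one
    nonzero tangent vector exists.

    Part (b) needs one example.  On the plane with coordinates
    (x_0, x_1, y_0, y_1) take G^0 = x_0 y_1^2 and G^1 = 0.  The
    diagonal entries of N vanish, and so does its second row; hence neither
    S(N^i_i) nor N^i_k N^k_i contributes to the trace, and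
    Ric = 2 dG^0/dx_0 = 2 y_1^2 ([ricci_example]).  This is not identically
    zero, but it depends neither on x_0 nor on y_0; therefore d/dx_0 is in the
    kernel of dd_J Ric ([ddJ_row_eq0]), which is degenerate.  What remains is
    to see the plane as a manifold and G as smooth: R^n is second countable
    because the rational points are dense ([second_countable_rV]), and
    polynomial maps are smooth because the functions of class C^k contain the
    continuous linear maps and are closed under sums and products
    ([ck_on_linear], [ck_onD], [ck_onM]). *)

Section SpraysAndRicciCurvature.
Local Open Scope classical_set_scope.
Local Open Scope ring_scope.

(** * Second countability of R^n *)

(** The balls of radius 1/(k+1) around the points of a dense set form a basis:
    a point x is within half such a radius of some q in the dense set, so that
    it is interior to the ball around q, and this ball is small when k is
    large.  Interiors are taken because the balls of a pseudometric space need
    not be open. *)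
Lemma second_countable_dense (R : realType) (T : pseudoMetricType R)
    (D : set T) : countable D -> dense D -> @second_countable T.
Proof.
move=> cD dD.
pose B k (q : T) : set T := (ball q (k.+1%:R^-1 : R))°.
exists (\bigcup_k (B k @` D)).
  apply: bigcup_countable => // k _.
  by apply: sub_countable cD; exact: card_image_le.
split; first by move=> _ [k _ [q _ <-]]; exact: open_interior.
move=> x U /nbhs_ballP[_/posnumP[e] xeU].
have [//|k] := @ltr_add_invr R 0 (e%:num / 2) _; rewrite add0r => ke.
have r0 : 0 < k.+1%:R^-1 / 2 :> R by rewrite divr_gt0.
have [q [/interior_subset xq Dq]] : (ball x (k.+1%:R^-1 / 2 : R))° `&` D !=set0.
  apply: dD; last exact: open_interior.
  by exists x; exact: (nbhsx_ballx x _ r0).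
exists (B k q); first split.
- by exists k => //; exists q.
- apply/nbhs_ballP; exists (k.+1%:R^-1 / 2 : R) => //= z xz.
  by rewrite [_^-1]splitr; apply: ball_triangle xz; exact: ball_sym.
- move=> z /interior_subset qz; apply: xeU.
  rewrite [e%:num]splitr; apply: (@ball_triangle _ _ q).
    apply: le_ball xq; apply: le_trans (ltW ke).
    by rewrite ler_pdivrMr// ler_peMr// ler1n.
  exact: le_ball (ltW ke) _ qz.
Qed.

Lemma dense_rat_rV (R : realType) n :
  dense ((fun q : 'rV[rat]_n => map_mx ratr q : 'rV[R]_n) @` setT).
Proof.
move=> O [x Ox]; rewrite openE => /(_ x Ox)/nbhs_ballP[_/posnumP[e] xeO].
have q_ i : {q : rat | ball (x 0 i) e%:num (ratr q : R)}.
  apply: cid.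
  have [y [xy [q _ qy]]] :
      (ball (x 0 i) e%:num)° `&` (@ratr R @` setT) !=set0.
    apply: dense_rat; last exact: open_interior.
    by exists (x 0 i); exact: nbhsx_ballx.
  by exists q; rewrite qy; exact: interior_subset xy.
exists (map_mx ratr (\row_i sval (q_ i))); split.
  by apply: xeO; split=> // i j; rewrite !mxE ord1; case: (q_ j).
by exists (\row_i sval (q_ i)).
Qed.

Lemma second_countable_rV (R : realType) n : @second_countable 'rV[R]_n.
Proof.
apply: second_countable_dense (@dense_rat_rV R n).
apply: sub_countable (countableP [set: 'rV[rat]_n]).
exact: card_image_le.
Qed.

(** * Functions of class C^k *)

Section ClassCk.
Variables (R : realType) (V W : normedModType R).

Lemma ck_on_sub k (A B : set V) (f : V -> W) :
  A `<=` B -> ck_on k B f -> ck_on k A f.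
Proof.
move=> AB; elim: k f => [|k IH] f /= => [cf p /AB|[df Df]]; first exact: cf.
by split=> [p /AB|v]; [exact: df|exact: IH].
Qed.

Lemma ck_onS k (A : set V) (f : V -> W) : ck_on k.+1 A f -> ck_on k A f.
Proof.
elim: k f => [|k IH] f [df Df].
  by move=> p /df /differentiable_continuous.
by split=> // v; exact: IH.
Qed.

Lemma ck_on_cst k (A : set V) (w : W) : ck_on k A (fun=> w).
Proof.
elim: k w => [|k IH] w; first by move=> p _; exact: cst_continuous.
split=> [p _|v]; first exact: differentiable_cst.
suff -> : (fun p => 'D_v (fun=> w) p) = (fun=> 0 : W) by exact: IH.
by apply/funext => p; exact: derive_cst.
Qed.

(** The directional derivatives of a continuous linear map are constant. *)
Lemma ck_on_linear k (A : set V) (f : {linear V -> W}) :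
  continuous f -> ck_on k A f.
Proof.
move=> cf; case: k => [|k]; first by move=> p _; exact: cf.
have df p : differentiable f p by exact: linear_differentiable.
split=> // v; suff -> : (fun p => 'D_v f p) = (fun=> f v) by exact: ck_on_cst.
by apply/funext => p; rewrite deriveE// diff_lin.
Qed.

(** On the whole space the formula for the derivative of a sum is an equality
    of functions, which the induction on k can rewrite with; on a smaller set
    it would only hold pointwise on that set. *)
Lemma ck_onD k (f g : V -> W) :
  ck_on k setT f -> ck_on k setT g -> ck_on k setT (fun p => f p + g p).
Proof.
elim: k f g => [|k IH] f g.
  by move=> cf cg p _; apply: (@continuousD _ _ _ f g); [exact: cf|exact: cg].
move=> [df Df] [dg Dg]; split=> [p _|v].
  by apply: (@differentiableD _ _ _ f g); [exact: df|exact: dg].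
rewrite (_ : (fun p => _) = (fun p => 'D_v f p + 'D_v g p)).
  exact: (IH _ _ (Df v) (Dg v)).
apply/funext => p; apply: (@deriveD _ _ _ f g); apply: diff_derivable.
  exact: (df p I).
exact: (dg p I).
Qed.

Lemma ck_onZl k (f : V -> R) (w : W) :
  ck_on k setT f -> ck_on k setT (fun p => f p *: w).
Proof.
elim: k f => [|k IH] f.
  move=> cf p _; apply: (@continuous_comp _ _ _ f (fun r => r *: w)).
    exact: cf.
  exact: scalel_continuous.
move=> [df Df]; split=> [p _|v]; first by apply: differentiableZl; exact: df.
rewrite (_ : (fun p => _) = (fun p => 'D_v f p *: w)); first exact: IH (Df v).
apply/funext => p; have dfp := df p I.
by rewrite deriveE ?diffZl ?deriveE//; exact: differentiableZl.
Qed.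

End ClassCk.

(** By the Leibniz rule the derivative of f g is f Dg + g Df; the
    undifferentiated factors are of class C^(k+1), so of class C^k, and the
    induction on k applies to both products. *)
Lemma ck_onM (R : realType) (V : normedModType R) k (f g : V -> R) :
  ck_on k setT f -> ck_on k setT g -> ck_on k setT (fun p => f p * g p).
Proof.
elim: k f g => [|k IH] f g.
  by move=> cf cg p _; apply: (@continuousM _ _ f g); [exact: cf|exact: cg].
move=> Cf Cg; have [df Df] := Cf; have [dg Dg] := Cg; split=> [p _|v].
  by apply: (@differentiableM _ _ f g); [exact: df|exact: dg].
rewrite (_ : (fun p => _) = (fun p => f p * 'D_v g p + g p * 'D_v f p)).
  exact: ck_onD (IH _ _ (ck_onS Cf) (Dg v)) (IH _ _ (ck_onS Cg) (Df v)).
apply/funext => p; apply: (@deriveM _ _ f g); apply: diff_derivable.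
  exact: (df p I).
exact: (dg p I).
Qed.

(** * Directional derivatives of special functions *)

Section Derive.
Variables (R : realType) (V W : normedModType R).

(** The difference quotient is the constant c.  With c = 0 this computes the
    derivative of a function that is invariant along v. *)
Lemma derive_affine (f : V -> W) (v p : V) (c : W) :
  (forall h, f (h *: v + p) = f p + h *: c) -> 'D_v f p = c.
Proof.
move=> fE; apply: cvg_lim => //; apply: cvg_near_cst.
near=> h; rewrite /= fE addrAC subrr add0r scalerA mulVf ?scale1r//.
near: h; exact: nbhs_dnbhs_neq.
Unshelve. all: by end_near. Qed.

Lemma derive_translation (f : V -> W) (a v p : V) :
  (forall q, f (a + q) = f q) -> 'D_v f (a + p) = 'D_v f p.
Proof.
move=> fa; rewrite /derive [X in X @ _](_ : _ =
    fun h => h^-1 *: ((f \o shift p) (h *: v) - f p))//.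
by apply/funext => h; rewrite /= addrCA !fa.
Qed.

Lemma derive_eq0_open (A : set V) (f : V -> W) (v p : V) :
  open A -> A p -> (forall q, A q -> f q = 0) -> 'D_v f p = 0.
Proof.
move=> oA Ap f0; rewrite -(derive_cst (0 : W) p v); apply: near_eq_derive.
by apply: filterS (open_nbhs_nbhs (conj oA Ap)) => q /f0.
Qed.

End Derive.

(** * Full rank forces non-vanishing Ricci curvature *)

Lemma ddJ_eq0_open (R : realType) n (A : set ('rV[R]_n * 'rV[R]_n)) f p :
  open A -> A p -> (forall q, A q -> f q = 0) -> ddJ f p = 0.
Proof.
move=> oA Ap f0.
have dJ0 b q : A q -> dJ f b q = 0.
  move=> Aq; rewrite /dJ; case: fintype.split => // i.
  exact: derive_eq0_open f0.
have d0 a b : dcoord a (dJ f b) p = 0.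
  by rewrite /dcoord; case: fintype.split => i; apply: derive_eq0_open (dJ0 b).
by apply/matrixP => a b; rewrite !mxE !d0 subrr.
Qed.

Lemma slit_coords_open (R : realType) n (M : manifold R n) (i : atlas M) :
  open (slit_coords i (dom i)).
Proof.
have -> : slit_coords i (dom i) =
    fst @^-1` (chart i @` dom i) `&` snd @^-1` (~` [set 0 : 'rV[R]_n]).
  by apply/seteqP; split => p [? /eqP].
apply: openI; (apply: open_comp; first move=> p _).
- exact: cvg_fst.
- exact: chart_image_open.
- exact: cvg_snd.
apply: closed_openC; apply: accessible_closed_set1.
by apply: hausdorff_accessible; exact: norm_hausdorff.
Qed.

Lemma slit_coords_nonempty (R : realType) n (M : manifold R n) : (0 < n)%N ->
  exists i : atlas M, slit_coords i (dom i) !=set0.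
Proof.
case: n M => // n M _; have [q _] := manifold_nonempty M.
have [i qi] := dom_cover q; exists i, (chart i q, const_mx 1); split => /=.
  by exists q.
by apply/eqP => /matrixP/(_ 0 0)/eqP; rewrite !mxE oner_eq0.
Qed.

Lemma full_rank_nonvanishing_ricci (R : realType) n (M : manifold R n)
    (S : spray M) :
  (0 < n)%N -> ddJ_trace_full_rank S -> nonvanishing_ricci S.
Proof.
move=> n_gt0 rk ric0; have [i [p ip]] := slit_coords_nonempty M n_gt0.
have := rk i p ip.
rewrite (ddJ_eq0_open (@slit_coords_open _ _ _ i) ip (ric0 i)) mxrank0.
by case: n n_gt0 {M S rk ric0 i p ip}.
Qed.

(** * Degenerate forms dd_J f *)

Lemma row_eq0_rank (F : fieldType) m n (A : 'M[F]_(m, n)) i :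
  row i A = 0 -> (\rank A < m)%N.
Proof.
move=> A0; rewrite ltn_neqAle rank_leq_row andbT.
apply/negP => /row_free_inj A_inj.
have /rowP/(_ i)/eqP : delta_mx 0 i = 0 :> 'rV[F]_m.
  by apply: A_inj; rewrite -rowE A0 mul0mx.
by rewrite !mxE !eqxx oner_eq0.
Qed.

(** The entries of the row of x_i are d/dx_i (theta_b) - d/dz_b (theta_i) with
    theta = d_J f and z_b the b-th of the coordinates (x, y).  The first term
    vanishes because the derivatives of f are as independent of x_i as f is;
    the second because theta_i = df/dy_i = 0. *)
Lemma ddJ_row_eq0 (R : realType) n (f : 'rV[R]_n * 'rV[R]_n -> R) (i : 'I_n)
    p :
  (forall h q, f (h *: (delta_mx 0 i, 0) + q) = f q) ->
  (forall h q, f (h *: (0, delta_mx 0 i) + q) = f q) ->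
  row (lshift n i) (ddJ f p) = 0.
Proof.
move=> fx fy.
have dyf : dy i f = fun=> 0.
  by apply/funext => q; apply: derive_affine => h; rewrite fy scaler0 addr0.
have dJi : dJ f (lshift n i) = fun=> 0.
  by rewrite /dJ; case: splitP => [j /= /val_inj <-|j /= /eqP]; rewrite ?dyf.
apply/rowP => b; rewrite !mxE dJi.
have -> : dcoord b (fun=> 0) p = 0 :> R.
  by rewrite /dcoord; case: fintype.split => j; exact: derive_cst.
rewrite subr0 /dcoord -[lshift n i]/(unsplit (inl i)) unsplitK.
apply: derive_affine => h; rewrite scaler0 addr0 /dJ.
by case: fintype.split => // j; apply: derive_translation => q; exact: fx.
Qed.

(** * A spray on the plane with degenerate dd_J Ric *)

Definition euclidean_space (R : realType) n : manifold R n.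
Proof.
pose charts (_ : unit) : 'rV[R]_n -> 'rV[R]_n := id.
refine (@Manifold R n 'rV[R]_n unit (fun=> setT) charts charts
  _ _ _ _ _ _ _ _ _ _).
- by exists 0.
- exact: norm_hausdorff.
- exact: second_countable_rV.
- by move=> i; exact: openT.
- by move=> q; exists tt.
- by move=> i; rewrite /charts image_id; exact: openT.
- by [].
- by move=> i q _; exact: cvg_id.
- by move=> i q _; exact: cvg_id.
- by move=> i j k; apply: (@ck_on_linear _ _ _ k _ idfun) => x; exact: cvg_id.
Defined.

Lemma tangent_map_id (R : realType) n :
  tangent_map (id : 'rV[R]_n -> 'rV[R]_n) = id.
Proof. by apply/funext => -[x y]; rewrite /tangent_map diff_val. Qed.

Section Example.
Variable R : realType.
Local Notation E := 'rV[R]_2.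

Definition x0 (p : E * E) : R := p.1 0 0.
Definition y1 (p : E * E) : R := p.2 0 1.

Lemma ck_on_x0 k : ck_on k setT x0.
Proof.
have lin : linear x0 by move=> a p q; rewrite /x0 !mxE.
pose f : {linear (E * E)%type -> R} :=
  HB.pack x0 (GRing.isLinear.Build _ _ _ _ _ lin).
apply: (@ck_on_linear _ _ _ k setT f) => p.
apply: (@continuous_comp _ _ _ fst (fun x : E => x 0 0)); first exact: cvg_fst.
exact: coord_continuous.
Qed.

Lemma ck_on_y1 k : ck_on k setT y1.
Proof.
have lin : linear y1 by move=> a p q; rewrite /y1 !mxE.
pose f : {linear (E * E)%type -> R} :=
  HB.pack y1 (GRing.isLinear.Build _ _ _ _ _ lin).
apply: (@ck_on_linear _ _ _ k setT f) => p.
apply: (@continuous_comp _ _ _ snd (fun x : E => x 0 1)); first exact: cvg_snd.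
exact: coord_continuous.
Qed.

Definition example_coef (p : E * E) : E :=
  (x0 p * (y1 p * y1 p)) *: delta_mx 0 0.

Definition example_spray : spray (euclidean_space R 2).
Proof.
refine (@Spray R 2 (euclidean_space R 2) (fun=> example_coef) _ _ _).
- move=> i k; apply: (@ck_on_sub _ _ _ _ _ setT) => //; apply: ck_onZl.
  exact: ck_onM (ck_on_x0 k) (ck_onM (ck_on_y1 k) (ck_on_y1 k)).
- move=> i p c _ _; rewrite /example_coef /x0 /y1 /= mxE scalerA expr2.
  by congr (_ *: _); rewrite (mulrACA c) [LHS]mulrCA.
- move=> i j p _.
  by rewrite (_ : transition i j = id)// tangent_map_id diff_val.
Defined.

Lemma example_coef0 p : coef example_coef 0 p = x0 p * (y1 p * y1 p).
Proof. by rewrite /coef !mxE mulr1. Qed.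

Lemma example_coef1 : coef example_coef 1 = fun=> 0.
Proof. by apply/funext => p; rewrite /coef !mxE mulr0. Qed.

Lemma example_connection00 : nonlin_connection example_coef 0 0 = fun=> 0.
Proof.
apply/funext => p; apply: derive_affine => h.
by rewrite !example_coef0 /x0 /y1 /= !mxE/= !mulr0 !add0r scaler0 addr0.
Qed.

Lemma example_connection1 j : nonlin_connection example_coef 1 j = fun=> 0.
Proof.
apply/funext => p; rewrite /nonlin_connection example_coef1.
exact: derive_cst.
Qed.

Lemma ricci_example p : ricci example_coef p = 2 * (y1 p * y1 p).
Proof.
have dx1 : dx 1 (coef example_coef 1) p = 0.
  by rewrite example_coef1; exact: derive_cst.
have dx0 : dx 0 (coef example_coef 0) p = y1 p * y1 p.
  apply: derive_affine => h.
  by rewrite !example_coef0 /x0 /y1 /= !mxE/= mulr1 mulr0 add0r mulrDl addrC.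
rewrite /ricci /mxtrace !big_ord_recl big_ord0 !mxE.
rewrite !big_ord_recl !big_ord0.
rewrite (_ : lift ord0 ord0 = 1 :> 'I_2); last exact/val_inj.
rewrite (_ : ord0 = 0 :> 'I_2)// example_connection00 !example_connection1.
by rewrite dx0 dx1 !derive_cst !(mulr0, mul0r, addr0, subr0).
Qed.

(** Ric = 2 y_1^2 does not vanish at the tangent vector d/dx_1, while the row
    of x_0 in dd_J Ric is zero everywhere, so at that vector too. *)
Lemma example_spray_degenerate :
  nonvanishing_ricci example_spray /\ ~ ddJ_trace_full_rank example_spray.
Proof.
pose i : atlas (euclidean_space R 2) := tt.
pose p : E * E := (0, delta_mx 0 1).
have p_slit : slit_coords i (dom i) p.
  split; first by exists 0.
  by apply/eqP => /matrixP/(_ 0 1)/eqP; rewrite !mxE oner_eq0.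
split=> [/(_ i p p_slit)/eqP|/(_ i p p_slit)/eqP].
  by rewrite /= ricci_example /y1 !mxE /= !mulr1 pnatr_eq0.
apply/negP; rewrite neq_ltn; apply/orP; left.
rewrite (_ : (fun q => _) = (fun q => 2 * (y1 q * y1 q))); last first.
  by apply/funext => q; exact: ricci_example.
rewrite mulSn mul1n; apply: (@row_eq0_rank _ _ _ _ (lshift 2 0)).
by apply: ddJ_row_eq0 => h q; rewrite /y1 /= !mxE /= ?mulr0 ?add0r.
Qed.

End Example.

End SpraysAndRicciCurvature.

Theorem proposition3p10 (R : realType) :
  (forall (n : nat) (M : manifold R n) (S : spray M),
      (2 <= n)%N -> ddJ_trace_full_rank S -> nonvanishing_ricci S)
  /\
  (exists (n : nat) (M : manifold R n) (S : spray M),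
      (2 <= n)%N /\ nonvanishing_ricci S /\ ~ ddJ_trace_full_rank S).
Proof.
split=> [n M S n2|]; first exact/full_rank_nonvanishing_ricci/ltnW.
exists 2%N, (euclidean_space R 2), (example_spray R).
by split=> //; exact: example_spray_degenerate.
Qed.
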